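(* Let $x$ be a nondegenerate plane curve in $\mathbf{A}^2$ without affine inflection points whose general-affine curvature $k$ is a nonzero constant. Then, as an unparametrized curve, $x$ is general-affinely congruent to (an arc of) one of the following curves: $e^{\gamma t}(\cos t,\sin t)$ with $\gamma\neq 0$; $(t,e^t)$; $(t,t\log t)$ with $t>0$; $(t,t^\alpha)$ with $t>0$ and a real constant $\alpha\neq 0,\pm1,2,\tfrac12$.
   Context: All curves are smooth and defined on an interval. Two curves are general-affinely congruent if one is carried to the other by an element of the general affine group $\mathrm{GA}(2)=\mathrm{GL}(2,\mathbf{R})\ltimes\mathbf{R}^2$. A parametrized curve $x=x(t)$ in $\mathbf{A}^2$ is nondegenerate if $x'$ and $x''$ are linearly independent at every point. For a nondegenerate curve there exist a frame $e_1,e_2$ along $x$ (smooth, pointwise linearly independent vector fields along $x$, with $e_1$ a positive multiple of $dx/dt$), a $1$-form $\omega$ and a function $\ell$ such that $dx=\omega e_1$, $de_1=\omega e_2$, $de_2=-\ell\omega e_1$. These are unique up to $\tilde e_1=\lambda e_1$, $\tilde e_2=\lambda^2e_2$, $\tilde\omega=\lambda^{-1}\omega$, $\tilde\ell=\lambda^2\ell$ with a constant $\lambda>0$. A point where $\ell=0$ is an affine inflection point. Where $\ell\ne0$, put $\epsilon=\mathrm{sign}(\ell)=\pm1$. The general-affine length element is $\omega_s=\sqrt{\epsilon\ell}\,\omega$, and the general-affine curvature $k$ is the function defined by $d\ell/\ell=k\,\omega_s$. Reversing the orientation of the parameter changes the sign of $k$. *)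

(* Defs.v *)
From HB Require Import structures.
From mathcomp Require Import all_boot all_order all_algebra.
From mathcomp Require Import all_classical all_reals all_analysis.

Set Implicit Arguments.
Unset Strict Implicit.
Unset Printing Implicit Defensive.

Import Order.TTheory GRing.Theory Num.Theory.
Import numFieldNormedType.Exports.

Local Open Scope classical_set_scope.
Local Open Scope ring_scope.

Section Calculus.
Context {R : realType} {V : normedModType R}.

(* The limit is taken inside [I], so that at an endpoint of [I] belonging to
   [I] the derivative is one-sided, and values of [f] outside [I] are
   irrelevant. At interior points this is the usual derivative. *)
Definition diff_quot (f : R -> V) (t s : R) : V := (s - t)^-1 *: (f s - f t).

Definition derivable_in (I : set R) (f : R -> V) (t : R) : Prop :=
  cvg (diff_quot f t s @[s --> within I t^']).

Definition derive_in (I : set R) (f : R -> V) (t : R) : V :=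
  lim (diff_quot f t s @[s --> within I t^']).

Definition smooth_in (I : set R) (f : R -> V) : Prop :=
  forall n t, I t -> derivable_in I (iter n (derive_in I) f) t.

End Calculus.

Section Plane.
Context {R : realType}.

Definition pt (a b : R) : 'cV[R]_2 := \col_i (if i == ord0 then a else b).

Definition ga_act (A : 'M[R]_2) (b : 'cV[R]_2) (p : 'cV[R]_2) : 'cV[R]_2 :=
  A *m p + b.

Definition nondegenerate_curve (I : set R) (x : R -> 'cV[R]_2) : Prop :=
  forall t, I t -> free [:: derive_in I x t; derive_in I (derive_in I x) t].

(* The 1-form is [omega = w dt]. *)
Record adapted_frame (I : set R) (x e1 e2 : R -> 'cV[R]_2) (w l : R -> R)
    : Prop := AdaptedFrame {
  frame_smooth1 : smooth_in I e1;
  frame_smooth2 : smooth_in I e2;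
  form_smooth : smooth_in I w;
  ell_smooth : smooth_in I l;
  frame_free : forall t, I t -> free [:: e1 t; e2 t];
  frame_pos : forall t, I t ->
    exists2 c : R, 0 < c & e1 t = c *: derive_in I x t;
  frame_dx : forall t, I t -> derive_in I x t = w t *: e1 t;
  frame_de1 : forall t, I t -> derive_in I e1 t = w t *: e2 t;
  frame_de2 : forall t, I t -> derive_in I e2 t = - (l t * w t) *: e1 t
}.

(* Adapted frames of a nondegenerate curve exist and are unique up to
   [l ~> lambda^2 l], [w ~> lambda^-1 w] with a constant [lambda > 0], so the
   next three notions do not depend on the frame witnessing them. *)
Definition affine_inflection (I : set R) (x : R -> 'cV[R]_2) (t : R) : Prop :=
  exists e1 e2 w l, adapted_frame I x e1 e2 w l /\ l t = 0.

(* The coefficient of [dt] in the general-affine length element. *)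
Definition ga_length_element (w l : R -> R) (t : R) : R :=
  Num.sqrt (Num.sg (l t) * l t) * w t.

Definition ga_curvature (I : set R) (x : R -> 'cV[R]_2) (k : R -> R) : Prop :=
  exists e1 e2 w l, adapted_frame I x e1 e2 w l /\
    forall t, I t -> derive_in I l t / l t = k t * ga_length_element w l t.

(* [x] on [I] and an arc of [c], [c] being defined on [D], are congruent as
   unparametrized curves: [phi] is a change of parameter, of either
   orientation, from [I] onto the interval [phi @` I]. *)
Definition ga_congruent_to_arc (I : set R) (x : R -> 'cV[R]_2)
    (D : set R) (c : R -> 'cV[R]_2) : Prop :=
  exists (A : 'M[R]_2) (b : 'cV[R]_2) (phi : R -> R),
    [/\ A \in unitmx,
        smooth_in I phi,
        forall t, I t -> derive_in I phi t != 0,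
        forall t, I t -> D (phi t) &
        forall t, I t -> ga_act A b (x t) = c (phi t)].

End Plane.

(* Main.v *)
Require Import Defs.
From mathcomp Require Import all_boot all_order all_algebra.
From mathcomp Require Import all_classical all_reals all_analysis.
From mathcomp Require Import ring lra.

Set Implicit Arguments.
Unset Strict Implicit.
Unset Printing Implicit Defensive.

Import Order.TTheory GRing.Theory Num.Theory.
Import numFieldNormedType.Exports.

Local Open Scope classical_set_scope.
Local Open Scope ring_scope.

(** The curvature equation [dl/l = k sqrt(eps l) w dt] says that
    [L = ln (sqrt (eps l))] satisfies [L' = (k/2) e^L w]. As [k] is a nonzero
    constant, [L] is therefore itself a parameter of the curve: up to the factor
    [k/2] it is the general-affine arc length, obtained without integrating
    anything, and [l = eps e^(2L)] is a function of it.

    The coordinates of [x] satisfy the linear system [y' = w g1], [g1' = w g2],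
    [g2' = - l w g1]. Its matrix, acting on [(g1, g2)], has trace zero, so the
    determinant [wronskian] of two solutions is constant; by Cramer's rule every
    solution is a constant combination of two independent ones and of the
    solution [1] ([solution_span]). Hence two plane curves whose coordinates
    solve the same system, and whose frames are independent, are affinely
    congruent ([congruent_of_structure]), and it suffices to exhibit curves
    given by functions [Y (L t)] of the parameter [L] that solve the system of
    [x]. For such functions the system reduces to the constant coefficient
    equation [Y''' + 3 Y'' + (2 + m) Y' = 0] with [m = 4 eps / k^2]
    ([model_structure]). Besides [0], its exponents are the roots [a], [b] of
    [X^2 + 3 X + 2 + m], and their nature decides among the four families:
    - two real nonzero roots: the solutions [e^(aL)], [e^(bL)] trace
      [(t, t^alpha)] with [t = e^(aL)] and [alpha = b / a];
    - the roots [0] and [-3] ([m = -2]): the solutions [-3 L], [e^(-3L)] trace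
      [(t, e^t)];
    - a double root [a = -3/2] ([m = 1/4]): the solutions [e^(aL)],
      [aL e^(aL)] trace [(t, t ln t)];
    - the roots [-3/2 +- i b]: the solutions [e^(-3L/2) cos (bL)],
      [e^(-3L/2) sin (bL)] trace the logarithmic spiral with [t = bL].
    The excluded values of [alpha] are impossible because [a + b = -3] is not
    zero, and because [b = 2 a] or [a = 2 b] would force [m = 0]. *)

(** * Calculus on an interval, one-sided at its endpoints *)

Definition has_deriv_in (R : realType) (V : normedModType R)
    (I : set R) (f : R -> V) (t : R) (d : V) : Prop :=
  diff_quot f t s @[s --> within I t^'] --> d.

Section Deriv.
Context {R : realType} (I : set R).
Hypotheses (itvI : is_interval I) (ntI : I° !=set0).
Implicit Types (f g h : R -> R) (t d : R).

(** An interval with nonempty interior accumulates at each of its points, so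
    that limits inside it are unique. *)
Lemma within_punctured_proper t : I t -> ProperFilter (within I t^').
Proof.
move=> It; apply: Build_ProperFilter_ex => B.
rewrite /within/= /dnbhs /within/= => /nbhs_ballP[e /= e0 eB].
have [c Ic ct] : exists2 c, I c & c != t.
  have [c Ic] := ntI.
  have [ct|ct] := eqVneq c t; last by exists c => //; exact: interior_subset.
  move: Ic; rewrite ct => /nbhs_ballP[r /= r0 rI].
  exists (t + r / 2); last by rewrite -subr_eq0 addrAC subrr add0r; lra.
  by apply: rI; rewrite /ball/= opprD addNKr normrN gtr0_norm; lra.
have nct : 0 < `|c - t| by rewrite normr_gt0 subr_eq0.
(* the point of the segment from [t] to [c] at distance at most [e / 2] *)
pose r := Num.min 1 (e / (2 * `|c - t|)).
have r0 : 0 < r by rewrite lt_min ltr01 divr_gt0// mulr_gt0.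
have r1 : r <= 1 by rewrite ge_min lexx.
have re : r * `|c - t| <= e / 2.
  have : r <= e / (2 * `|c - t|) by rewrite ge_min lexx orbT.
  by rewrite ler_pdivlMr ?mulr_gt0// => h; lra.
have sI : I (t + r * (c - t)).
  have [ct'|tc] := leP c t.
    by apply: (itvI Ic It); apply/andP; split; nra.
  by apply: (itvI It Ic); apply/andP; split; nra.
exists (t + r * (c - t)); apply: eB => //.
  by rewrite /ball/= opprD addNKr normrN normrM gtr0_norm//; lra.
by rewrite -subr_eq0 addrAC subrr add0r mulf_neq0 ?subr_eq0// gt_eqF.
Qed.

Lemma derivable_in_has_deriv (V : normedModType R) (f : R -> V) t :
  derivable_in I f t -> has_deriv_in I f t (derive_in I f t).
Proof. by []. Qed.

Lemma has_deriv_in_unique (V : normedModType R) (f : R -> V) t (d : V) : I t ->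
  has_deriv_in I f t d -> derivable_in I f t /\ derive_in I f t = d.
Proof.
move=> It fd; split; first by apply/cvg_ex; exists d.
by apply: cvg_lim; [exact: norm_hausdorff|exact: within_punctured_proper|].
Qed.

Lemma has_deriv_in_ext (V : normedModType R) (f g : R -> V) t (d : V) : I t ->
  (forall s, I s -> f s = g s) -> has_deriv_in I f t d -> has_deriv_in I g t d.
Proof.
move=> It fg; apply: cvg_trans; apply: near_eq_cvg.
apply: filterS (@withinT _ t^' I _) => s Is.
by rewrite /diff_quot (fg t)// (fg s).
Qed.

Lemma has_deriv_in_eq f t d d' : has_deriv_in I f t d -> d = d' ->
  has_deriv_in I f t d'.
Proof. by move=> + <-. Qed.

(** The difference quotient is not continuous at [s = t]; a slope [q] that is
    makes the product and chain rules algebraic identities. *)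
Lemma has_deriv_in_caratheodory f t d : I t ->
  has_deriv_in I f t d <->
  exists q : R -> R, [/\ forall s, f s - f t = q s * (s - t),
    q s @[s --> within I (nbhs t)] --> d & q t = d].
Proof.
move=> It; split.
  move=> fd; exists (fun s => if s == t then d else diff_quot f t s).
  split; last by rewrite eqxx.
    move=> s; case: eqVneq => [->|st]; first by rewrite !subrr mulr0.
    by rewrite /diff_quot /GRing.scale/= mulrC mulVKf// subr_eq0.
  move=> P Pd.
  have : nbhs t (fun s => s != t -> I s -> P (diff_quot f t s)) := fd P Pd.
  apply: filterS => s; rewrite /preimage/=.
  by case: eqVneq => [_ _ _|st /(_ isT)//]; exact: nbhs_singleton.
case=> q [fq qd _] P Pd.
have : nbhs t (fun s => I s -> P (q s)) := qd P Pd.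
apply: filterS => s Pq st /Pq; rewrite /preimage/= /diff_quot fq /GRing.scale/=.
by rewrite mulrC mulfK// subr_eq0.
Qed.

Lemma has_deriv_in_continuous f t d : I t -> has_deriv_in I f t d ->
  f s @[s --> within I (nbhs t)] --> f t.
Proof.
move=> It /(has_deriv_in_caratheodory _ _ It)[q [fq qd qt]].
have -> : f = (fun s => f t + q s * (s - t)).
  by apply/funext => s; rewrite -fq addrC subrK.
have s0 : s - t @[s --> within I (nbhs t)] --> t - t.
  by apply: cvgB; [exact: cvg_within|exact: cvg_cst].
by rewrite /= qt; apply: cvgD; [exact: cvg_cst|exact: cvgM].
Qed.

Lemma has_deriv_in_cst (a : R) t : I t -> has_deriv_in I (fun=> a) t 0.
Proof.
move=> It; apply/has_deriv_in_caratheodory => //; exists (fun=> 0); split => //.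
  by move=> s; rewrite subrr mul0r.
exact: cvg_cst.
Qed.

Lemma has_deriv_inD f g t d d' : I t ->
  has_deriv_in I f t d -> has_deriv_in I g t d' ->
  has_deriv_in I (fun s => f s + g s) t (d + d').
Proof.
move=> It /(has_deriv_in_caratheodory _ _ It)[p [fp pd pt]].
move=> /(has_deriv_in_caratheodory _ _ It)[q [fq qd qt]].
apply/has_deriv_in_caratheodory => //; exists (fun s => p s + q s); split.
- by move=> s; rewrite mulrDl -fp -fq; ring.
- exact: cvgD.
- by rewrite pt qt.
Qed.

Lemma has_deriv_inM f g t d d' : I t ->
  has_deriv_in I f t d -> has_deriv_in I g t d' ->
  has_deriv_in I (fun s => f s * g s) t (d * g t + f t * d').
Proof.
move=> It fd; have fc := has_deriv_in_continuous It fd; move: fd.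
move=> /(has_deriv_in_caratheodory _ _ It)[p [fp pd pt]].
move=> /(has_deriv_in_caratheodory _ _ It)[q [fq qd qt]].
apply/has_deriv_in_caratheodory => //.
exists (fun s => p s * g t + f s * q s); split.
- by move=> s; rewrite mulrDl mulrAC -fp -mulrA -fq; ring.
- apply: cvgD; last exact: cvgM.
  by apply: cvgM => //; exact: cvg_cst.
- by rewrite pt qt.
Qed.

Lemma has_deriv_inZ (a : R) f t d : I t -> has_deriv_in I f t d ->
  has_deriv_in I (fun s => a * f s) t (a * d).
Proof.
move=> It fd; have := has_deriv_inM It (has_deriv_in_cst a It) fd.
by rewrite mul0r add0r.
Qed.

Lemma has_deriv_inN f t d : I t -> has_deriv_in I f t d ->
  has_deriv_in I (fun s => - f s) t (- d).
Proof.
move=> It /(has_deriv_inZ (a := -1) It); rewrite mulN1r.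
by apply: has_deriv_in_ext => // s _; rewrite mulN1r.
Qed.

Lemma has_deriv_in_comp (h : R -> R) f t d d' : I t ->
  has_deriv_in I f t d -> is_derive (f t) 1 h d' ->
  has_deriv_in I (h \o f) t (d' * d).
Proof.
move=> It fd; have fc := has_deriv_in_continuous It fd; move: fd.
move=> /(has_deriv_in_caratheodory _ _ It)[p [fp pd pt]].
move=> /is_derive1_caratheodory[q [fq qd qt]].
apply/has_deriv_in_caratheodory => //.
exists (fun s => q (f s) * p s); split.
- by move=> s; rewrite /= fq fp mulrA.
- by apply: cvgM => //; apply: cvg_comp fc _; rewrite -qt; exact: qd.
- by rewrite pt qt.
Qed.

Lemma coord_has_deriv_in (x : R -> 'cV[R]_2) t (v : 'cV[R]_2) i : I t ->
  has_deriv_in I x t v -> has_deriv_in I (fun s => x s i 0) t (v i 0).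
Proof.
move=> It xv.
have := cvg_comp _ _ xv (@coord_continuous _ _ _ i 0 v).
apply: cvg_trans; apply: near_eq_cvg; near=> s.
by rewrite /= /diff_quot !mxE.
Unshelve. all: by end_near. Qed.

Lemma within_itv_continuous f a b : I a -> I b ->
  (forall t, I t -> exists d, has_deriv_in I f t d) ->
  {within `[a, b], continuous f}.
Proof.
move=> Ia Ib fI; apply/subspace_continuousP => t /= tab.
have abI : `[a, b] `<=` I by move=> s /=; rewrite in_itv/= => /(itvI Ia Ib).
have [d /(has_deriv_in_continuous (abI _ tab)) fc] := fI _ (abI _ tab).
by apply: cvg_trans fc; apply: cvg_app; apply: within_subset.
Qed.

Lemma has_deriv_in_is_derive f t d : I° t -> has_deriv_in I f t d ->
  is_derive t 1 f d.
Proof.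
move=> It /(has_deriv_in_caratheodory _ _ (interior_subset It))[q [fq qd qt]].
apply/is_derive1_caratheodory; exists q; split => //.
by move: qd; rewrite within_interior// -qt.
Qed.

Lemma has_deriv_in0_cst f a b : (forall t, I t -> has_deriv_in I f t 0) ->
  I a -> I b -> f a = f b.
Proof.
move=> f0; wlog ab : a b / a < b => [hw Ia Ib|Ia Ib].
  by have [/hw->//|/hw->//|->] := ltgtP a b.
have abI : `]a, b[ `<=` I°.
  rewrite -open_subsetE; last exact: interval_open.
  move=> s /=; rewrite in_itv/= => /andP[/ltW as_ /ltW sb].
  by apply: (itvI Ia Ib); rewrite as_ sb.
have [||c _] := @MVT R f (fun=> 0) a b ab.
- move=> t tab; have It := abI _ tab.
  by apply: has_deriv_in_is_derive => //; apply: f0; exact: interior_subset.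
- by apply: within_itv_continuous => // t It; exists 0; exact: f0.
- by rewrite mul0r => /eqP; rewrite subr_eq0 => /eqP.
Qed.

Lemma same_sign_in f a b : (forall t, I t -> exists d, has_deriv_in I f t d) ->
  (forall t, I t -> f t != 0) -> I a -> I b -> 0 < f a -> 0 < f b.
Proof.
move=> fd f0 Ia Ib fa; rewrite lt_neqAle eq_sym f0//= leNgt; apply/negP => fb.
have [ab|ba] := leP a b.
- have [|c cab fc] := IVT ab (within_itv_continuous Ia Ib fd) (v := 0).
    by rewrite ge_min (ltW fb) orbT/= le_max (ltW fa).
  move: cab; rewrite in_itv/= => /(itvI Ia Ib)/f0.
  by rewrite fc eqxx.
- have [|c cab fc] := IVT (ltW ba) (within_itv_continuous Ib Ia fd) (v := 0).
    by rewrite ge_min (ltW fb)/= le_max (ltW fa) orbT.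
  move: cab; rewrite in_itv/= => /(itvI Ib Ia)/f0.
  by rewrite fc eqxx.
Qed.

(** * Closure properties of smooth functions *)

(** Peeling the derivatives off on the inside, unlike [iter] in [smooth_in],
    lets the product rule be used by induction on [n]. *)
Fixpoint diff_in (n : nat) f : Prop :=
  if n is m.+1 then
    (forall t, I t -> derivable_in I f t) /\ diff_in m (derive_in I f)
  else True.

Lemma smooth_inP f : smooth_in I f <-> forall n, diff_in n f.
Proof.
split=> [fs n|fs n].
  elim: n f fs => [//|n IH] f fs; split=> [t It|]; first exact: (fs 0%N).
  by apply: IH => m t It; rewrite -iterSr; exact: (fs m.+1).
elim: n f fs => [|n IH] f fs t It; first by have [/(_ t It)] := fs 1%N.
by rewrite iterSr; apply: IH It => m; have [] := fs m.+1.
Qed.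

Lemma smooth_has_deriv_in f t : smooth_in I f -> I t ->
  has_deriv_in I f t (derive_in I f t).
Proof. by move=> /(_ 0) fs It; exact: fs. Qed.

Lemma derivable_in_ext f g t : I t ->
  (forall s, I s -> f s = g s) -> derivable_in I f t ->
  derivable_in I g t /\ derive_in I g t = derive_in I f t.
Proof.
move=> It fg /derivable_in_has_deriv fd.
by apply: has_deriv_in_unique => //; apply: has_deriv_in_ext fd.
Qed.

Lemma diff_in_ext n f g : (forall s, I s -> f s = g s) ->
  diff_in n f -> diff_in n g.
Proof.
elim: n f g => [//|n IH] f g fg [fd fn]; split=> [t It|].
  by have [] := derivable_in_ext It fg (fd t It).
by apply: IH fn => t It; have [_ ->] := derivable_in_ext It fg (fd t It).
Qed.

Lemma diff_inW n f : diff_in n.+1 f -> diff_in n f.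
Proof.
elim: n f => [//|n IH] f [fd fn]; split=> [t It|]; first exact: fd.
exact: IH.
Qed.

Lemma diff_in_of_deriv n f g : (forall t, I t -> has_deriv_in I f t (g t)) ->
  diff_in n g -> diff_in n.+1 f.
Proof.
move=> fg gn; split=> [t It|].
  by have [] := has_deriv_in_unique It (fg t It).
apply: diff_in_ext gn => t It.
by have [_ ->] := has_deriv_in_unique It (fg t It).
Qed.

Lemma diff_inD n f g : diff_in n f -> diff_in n g ->
  diff_in n (fun t => f t + g t).
Proof.
elim: n f g => [//|n IH] f g [fd fn] [gd gn].
apply: diff_in_of_deriv (IH _ _ fn gn) => t It.
exact: has_deriv_inD It (fd t It) (gd t It).
Qed.

Lemma diff_inM n f g : diff_in n f -> diff_in n g ->
  diff_in n (fun t => f t * g t).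
Proof.
elim: n f g => [//|n IH] f g fn gn; have [fd fn'] := fn; have [gd gn'] := gn.
apply: diff_in_of_deriv (diff_inD (IH _ _ fn' (diff_inW gn))
  (IH _ _ (diff_inW fn) gn')) => t It.
exact: has_deriv_inM It (fd t It) (gd t It).
Qed.

Lemma smooth_inM f g : smooth_in I f -> smooth_in I g ->
  smooth_in I (fun t => f t * g t).
Proof.
by move=> /smooth_inP fs /smooth_inP gs; apply/smooth_inP => n; exact: diff_inM.
Qed.

Lemma smooth_in_of_deriv f g : (forall t, I t -> has_deriv_in I f t (g t)) ->
  smooth_in I g -> smooth_in I f.
Proof.
move=> fg /smooth_inP gs; apply/smooth_inP => n.
by apply/diff_inW; exact: diff_in_of_deriv fg (gs n).
Qed.

Lemma smooth_in_cst (a : R) : smooth_in I (fun=> a).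
Proof.
apply/smooth_inP => n; elim: n a => [//|n IH] a.
by apply: (diff_in_of_deriv _ (IH 0)) => t; exact: has_deriv_in_cst.
Qed.

Lemma smooth_inZ (a : R) f : smooth_in I f -> smooth_in I (fun t => a * f t).
Proof. by move=> fs; have := smooth_inM (smooth_in_cst (a := a)) fs; exact. Qed.

(** If [f] is [n] times differentiable then so is [h * f], which makes [f]
    differentiable once more. *)
Lemma smooth_in_linear_ode f h : smooth_in I h ->
  (forall t, I t -> has_deriv_in I f t (h t * f t)) -> smooth_in I f.
Proof.
move=> /smooth_inP hs fh; apply/smooth_inP; elim=> [//|n IH].
by apply: (diff_in_of_deriv fh); exact: diff_inM.
Qed.

(** * Curves with the same structure equations *)

(** One coordinate of a curve [x] with [dx = w e1 dt], [de1 = w e2 dt] and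
    [de2 = - l w e1 dt]. *)
Definition solves_structure (w l y g1 g2 : R -> R) : Prop :=
  forall t, I t -> [/\ has_deriv_in I y t (w t * g1 t),
    has_deriv_in I g1 t (w t * g2 t) &
    has_deriv_in I g2 t (- (l t * w t) * g1 t)].

Definition wronskian (f1 f2 g1 g2 : R -> R) (t : R) : R :=
  f1 t * g2 t - f2 t * g1 t.

(** The matrix of the system satisfied by [(g1, g2)] has trace zero. *)
Lemma wronskian_cst w l y g1 g2 z h1 h2 s t :
  solves_structure w l y g1 g2 -> solves_structure w l z h1 h2 ->
  I s -> I t -> wronskian g1 g2 h1 h2 s = wronskian g1 g2 h1 h2 t.
Proof.
move=> ys zs; apply: has_deriv_in0_cst => r Ir.
have [_ dg1 dg2] := ys r Ir; have [_ dh1 dh2] := zs r Ir.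
apply: (has_deriv_in_eq (has_deriv_inD Ir (has_deriv_inM Ir dg1 dh2)
  (has_deriv_inN Ir (has_deriv_inM Ir dg2 dh1)))).
ring.
Qed.

(** Cramer's rule: the coefficients are quotients of constant wronskians. *)
Lemma solution_span w l p p1 p2 q q1 q2 z z1 z2 t0 : I t0 ->
  solves_structure w l p p1 p2 -> solves_structure w l q q1 q2 ->
  solves_structure w l z z1 z2 -> wronskian p1 p2 q1 q2 t0 != 0 ->
  exists a b c, forall t, I t -> [/\ z t = a * p t + b * q t + c,
    z1 t = a * p1 t + b * q1 t & z2 t = a * p2 t + b * q2 t].
Proof.
move=> I0 ps qs zs W0.
pose W := wronskian p1 p2 q1 q2 t0.
pose a := wronskian z1 z2 q1 q2 t0 / W.
pose b := wronskian p1 p2 z1 z2 t0 / W.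
have z12 t : I t -> z1 t = a * p1 t + b * q1 t /\ z2 t = a * p2 t + b * q2 t.
  move=> It; rewrite /a /b /W.
  rewrite (wronskian_cst zs qs I0 It) (wronskian_cst ps zs I0 It).
  have Wt := wronskian_cst ps qs I0 It; rewrite Wt in W0 *.
  move: W0; rewrite /wronskian => W0.
  by split; field.
exists a, b, (z t0 - (a * p t0 + b * q t0)) => t It.
have [zt1 zt2] := z12 _ It; split => //.
pose f s := z s - (a * p s + b * q s).
suff : f t = f t0 by rewrite /f => <-; ring.
apply: has_deriv_in0_cst It I0 => s Is.
have [dp _ _] := ps s Is; have [dq _ _] := qs s Is; have [dz _ _] := zs s Is.
apply: (has_deriv_in_eq (has_deriv_inD Is dz (has_deriv_inN Is (has_deriv_inD Is
  (has_deriv_inZ (a := a) Is dp) (has_deriv_inZ (a := b) Is dq))))).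
by have [-> _] := z12 _ Is; ring.
Qed.

Lemma det2 (M : 'M[R]_2) : \det M = M 0 0 * M 1 1 - M 0 1 * M 1 0.
Proof.
rewrite (expand_det_row _ 0) !big_ord_recl big_ord0 addr0 /cofactor !det_mx11.
rewrite !mxE /= /bump /= expr0 mul1r expr1.
rewrite (_ : lift 0 0 = 1); last exact/val_inj.
rewrite (_ : lift 1 0 = 0); last exact/val_inj.
ring.
Qed.

Lemma free2_det (a b : 'cV[R]_2) : free [:: a; b] ->
  a 0 0 * b 1 0 - b 0 0 * a 1 0 != 0.
Proof.
rewrite free_cons span_seq1 seq1_free => /andP[ab b0].
apply: contra ab; rewrite subr_eq0 => /eqP h; apply/vlineP.
have [b00|b00] := eqVneq (b 0 0) 0.
  have b10 : b 1 0 != 0.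
    apply: contra b0 => /eqP b10; apply/eqP/colP => i; rewrite mxE.
    by case: i => -[|[|//]] i2; [rewrite -[RHS]b00|rewrite -[RHS]b10];
      congr (b _ 0); apply/val_inj.
  have a00 : a 0 0 = 0.
    move: h; rewrite b00 mul0r => /eqP.
    by rewrite mulf_eq0 (negbTE b10) orbF => /eqP.
  exists (a 1 0 / b 1 0); apply/colP => i; rewrite mxE.
  case: i => -[|[|//]] i2.
    by rewrite (_ : Ordinal i2 = 0) ?a00 ?b00 ?mulr0//; apply/val_inj.
  by rewrite (_ : Ordinal i2 = 1) ?divfK//; apply/val_inj.
exists (a 0 0 / b 0 0); apply/colP => i; rewrite mxE.
case: i => -[|[|//]] i2.
  by rewrite (_ : Ordinal i2 = 0) ?divfK//; apply/val_inj.
rewrite (_ : Ordinal i2 = 1); last exact/val_inj.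
by rewrite mulrAC h mulrAC divff// mul1r.
Qed.

(** The coordinates of [x] together with the constants span the solutions of
    the system, so [(u, v)] is an affine image of [x]; the linear part is
    invertible because it carries the frame of [x] to that of [(u, v)]. *)
Lemma congruent_of_structure (x e1 e2 : R -> 'cV[R]_2) w l u u1 u2 v v1 v2 t0 :
  I t0 ->
  (forall i, solves_structure w l (fun t => x t i 0)
     (fun t => e1 t i 0) (fun t => e2 t i 0)) ->
  free [:: e1 t0; e2 t0] ->
  solves_structure w l u u1 u2 -> solves_structure w l v v1 v2 ->
  wronskian u1 u2 v1 v2 t0 != 0 ->
  exists A b, A \in unitmx /\
    forall t, I t -> ga_act A b (x t) = pt (u t) (v t).
Proof.
move=> I0 xs /free2_det e0 us vs uv0.
have W0 : wronskian (fun t => e1 t 0 0) (fun t => e2 t 0 0)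
  (fun t => e1 t 1 0) (fun t => e2 t 1 0) t0 != 0 by [].
have [a [b [c uE]]] := solution_span I0 (xs 0) (xs 1) us W0.
have [a' [b' [c' vE]]] := solution_span I0 (xs 0) (xs 1) vs W0.
exists (\matrix_(i < 2, j < 2) (if i == 0 then if j == 0 then a else b
  else if j == 0 then a' else b')), (pt c c'); split.
  rewrite unitmxE det2 !mxE/= unitfE; apply: contra uv0 => /eqP d0.
  have [_ u1E u2E] := uE _ I0; have [_ v1E v2E] := vE _ I0.
  rewrite /wronskian u1E u2E v1E v2E.
  apply/eqP; transitivity ((a * b' - b * a') *
    (e1 t0 0 0 * e2 t0 1 0 - e2 t0 0 0 * e1 t0 1 0)); first ring.
  by rewrite d0 mul0r.
move=> t It; have [u_ _ _] := uE t It; have [v_ _ _] := vE t It.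
apply/colP => i; rewrite /ga_act !mxE !big_ord_recl big_ord0 addr0 !mxE/=.
rewrite (_ : lift ord0 ord0 = 1); last exact/val_inj.
by case: i => -[|[|//]] i2 /=; rewrite -?u_ -?v_.
Qed.

(** * The structure equations in the logarithmic parameter *)

(** The third order equation satisfied by the coordinates of the curve as
    functions of [ln (sqrt (eps l))]. *)
Definition log_solution (m : R) (Y Y1 Y2 : R -> R) : Prop :=
  [/\ forall r : R, is_derive r (1 : R) Y (Y1 r),
      forall r : R, is_derive r (1 : R) Y1 (Y2 r) &
      forall r : R,
        is_derive r (1 : R) Y2 (- 3 * Y2 r - (2 + m) * Y1 r)].

(** With [s = e^L], so that [s' = (k/2) s^2 w] and [l = eps s^2], the frame of
    [Y (L t)] is [g1 = (k/2) s Y1] and [g2 = (k^2/4) s^2 (Y1 + Y2)], and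
    [g2' = - l w g1] becomes the equation of [log_solution]. *)
Lemma model_structure (k eps : R) (w l L Y Y1 Y2 : R -> R) : k != 0 ->
  (forall t, I t -> l t = eps * expR (L t) ^+ 2) ->
  (forall t, I t -> has_deriv_in I L t (k / 2 * expR (L t) * w t)) ->
  log_solution (4 * eps / k ^+ 2) Y Y1 Y2 ->
  solves_structure w l (Y \o L)
    (fun t => k / 2 * (expR (L t) * Y1 (L t)))
    (fun t => k ^+ 2 / 4 * (expR (L t) * (expR (L t) * (Y1 (L t) + Y2 (L t))))).
Proof.
move=> k0 lE dL [dY dY1 dY2] t It.
have dYt := has_deriv_in_comp It (dL t It) (dY (L t)).
have dY1t := has_deriv_in_comp It (dL t It) (dY1 (L t)).
have dY2t := has_deriv_in_comp It (dL t It) (dY2 (L t)).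
have dE := has_deriv_in_comp It (dL t It) (is_derive_expR (L t)).
split.
- by apply: (has_deriv_in_eq dYt); ring.
- apply: (has_deriv_in_eq (has_deriv_inZ It (has_deriv_inM It dE dY1t))).
  by rewrite /=; field.
- apply: (has_deriv_in_eq (has_deriv_inZ It (has_deriv_inM It dE
    (has_deriv_inM It dE (has_deriv_inD It dY1t dY2t))))).
  by rewrite lE//=; field.
Qed.

End Deriv.

(** * Reduction to the logarithmic parameter *)

Section Classification.
Context {R : realType} (I : set R).
Hypotheses (itvI : is_interval I) (ntI : I° !=set0).
Implicit Types (x e : R -> 'cV[R]_2) (w l : R -> R) (k : R).

Lemma frame_speed_neq0 x e1 e2 w l t : adapted_frame I x e1 e2 w l ->
  I t -> w t != 0.
Proof.
move=> fr It; have [c _ e1E] := frame_pos fr It.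
apply/eqP => w0; have := free2_det (frame_free fr It).
by rewrite e1E (frame_dx fr It) w0 scale0r scaler0 !mxE mul0r mulr0 subrr eqxx.
Qed.

Lemma frame_structure x e1 e2 w l i : smooth_in I x ->
  adapted_frame I x e1 e2 w l ->
  solves_structure I w l (fun t => x t i 0) (fun t => e1 t i 0)
    (fun t => e2 t i 0).
Proof.
move=> xs fr t It; have dE (f : R -> 'cV[R]_2) : smooth_in I f ->
    has_deriv_in I (fun s => f s i 0) t (derive_in I f t i 0).
  move=> fs; apply: coord_has_deriv_in => //.
  by apply: derivable_in_has_deriv; exact: (fs 0).
split.
- by have := dE _ xs; rewrite (frame_dx fr It) mxE.
- by have := dE _ (frame_smooth1 fr); rewrite (frame_de1 fr It) mxE.
- by have := dE _ (frame_smooth2 fr); rewrite (frame_de2 fr It) mxE.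
Qed.

(** Constancy of the sign [eps] of [l] makes [L = ln (eps l) / 2] available;
    then [e^L = sqrt (eps l)], and the curvature equation is the derivative of
    [L]. *)
Lemma log_scale x e1 e2 w l k : adapted_frame I x e1 e2 w l ->
  (forall t, I t -> l t != 0) ->
  (forall t, I t -> derive_in I l t / l t = k * ga_length_element w l t) ->
  exists eps, eps ^+ 2 = 1 /\ exists L : R -> R, forall t, I t ->
    l t = eps * expR (L t) ^+ 2 /\
    has_deriv_in I L t (k / 2 * expR (L t) * w t).
Proof.
move=> fr l0 lk.
have dl t : I t -> has_deriv_in I l t (derive_in I l t).
  exact: smooth_has_deriv_in (ell_smooth fr).
have [t0 /interior_subset I0] := ntI.
have [eps eps2 [epsl epsE]] : exists2 eps : R, eps ^+ 2 = 1 &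
    (forall t, I t -> 0 < eps * l t) /\ forall t, I t -> Num.sg (l t) = eps.
  have lex : forall t, I t -> exists d, has_deriv_in I l t d.
    by move=> t It; eexists; exact: dl.
  have [lt0|lt0] := ltP 0 (l t0).
    exists 1; first by rewrite expr1n.
    have lp t : I t -> 0 < l t.
      by move=> It; exact: (same_sign_in itvI lex l0 I0 It).
    by split=> t It; [rewrite mul1r lp|rewrite gtr0_sg// lp].
  exists (-1); first by rewrite sqrrN expr1n.
  have lp t : I t -> 0 < - l t.
    move=> It; apply: (same_sign_in itvI (f := fun t => - l t) _ _ I0 It).
    - by move=> s Is; eexists; apply: has_deriv_inN => //; exact: dl.
    - by move=> s Is; rewrite oppr_eq0 l0.
    - by rewrite oppr_gt0 lt_neqAle l0.
  by split=> t It; [rewrite mulN1r lp|rewrite ltr0_sg// -oppr_gt0 lp].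
exists eps; split => //; exists (fun t => 2^-1 * ln (eps * l t)) => t It.
have E2 : expR (2^-1 * ln (eps * l t)) ^+ 2 = eps * l t.
  by rewrite -expRM_natl mulVKf ?pnatr_eq0// lnK ?posrE ?epsl.
split; first by rewrite E2 mulrA -expr2 eps2 mul1r.
have dln : is_derive (eps * l t) (1 : R) (@ln R) (eps * l t)^-1.
  exact: is_derive1_ln (epsl t It).
have := has_deriv_inZ (a := 2^-1) It
  (has_deriv_in_comp It (has_deriv_inZ (a := eps) It (dl t It)) dln).
move/has_deriv_in_eq; apply.
have h := lk t It.
rewrite /ga_length_element epsE// -E2 sqrtr_sqr ger0_norm ?expR_ge0// in h.
have eps0 : eps != 0.
  by apply: contraTneq (epsl t It) => ->; rewrite mul0r ltxx.
transitivity (2^-1 * (derive_in I l t / l t)).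
  by field; rewrite l0 ?eps0.
by rewrite h; field.
Qed.

Definition fundamental_pair (m : R) (Y Z : R -> R) : Prop :=
  exists Y1 Y2 Z1 Z2 : R -> R, [/\ log_solution m Y Y1 Y2,
    log_solution m Z Z1 Z2 & forall r : R, wronskian Y1 Y2 Z1 Z2 r != 0].

(** The constant [m] is [4 eps / k^2], and [h] is [(k/2) e^L w]. Smoothness of
    [h] comes from [(e^L)' = (k/2) e^(2L) w = (k/2) eps l w], where [l] and [w]
    are smooth. *)
Lemma congruent_fundamental_pair x k : smooth_in I x ->
  (forall t, I t -> ~ affine_inflection I x t) -> k != 0 ->
  ga_curvature I x (fun=> k) ->
  exists2 m : R, m != 0 & exists h L : R -> R, [/\ smooth_in I h,
    forall t, I t -> h t != 0, forall t, I t -> has_deriv_in I L t (h t) &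
    forall Y Z, fundamental_pair m Y Z -> exists A b, A \in unitmx /\
      forall t, I t -> ga_act A b (x t) = pt (Y (L t)) (Z (L t))].
Proof.
move=> xs noinfl k0 [e1 [e2 [w [l [fr lk]]]]].
have l0 t : I t -> l t != 0.
  by move=> It; apply/eqP => lt0; apply: (noinfl t It); exists e1, e2, w, l.
have [eps [eps2 [L Lp]]] := log_scale fr l0 lk.
have dL t : I t -> has_deriv_in I L t (k / 2 * expR (L t) * w t).
  by move=> /Lp[].
have lE t : I t -> l t = eps * expR (L t) ^+ 2 by move=> /Lp[].
have eps0 : eps != 0 by rewrite -sqrf_eq0 eps2 oner_neq0.
have ws := form_smooth fr.
exists (4 * eps / k ^+ 2).
  by rewrite !mulf_neq0 ?invr_eq0 ?expf_neq0// pnatr_eq0.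
exists (fun t => k / 2 * expR (L t) * w t), L; split=> [|t It|t It|].
- have lw := smooth_inZ itvI ntI (a := k / 2 * eps)
    (smooth_inM itvI ntI (ell_smooth fr) ws).
  have Es : smooth_in I (expR \o L).
    apply: (smooth_in_of_deriv itvI ntI _ lw) => t It.
    have := has_deriv_in_comp It (dL t It) (is_derive_expR (L t)).
    move/has_deriv_in_eq; apply; rewrite lE//.
    transitivity (eps ^+ 2 * (k / 2 * expR (L t) ^+ 2 * w t)); last ring.
    by rewrite eps2; ring.
  have Ew := smooth_inM itvI ntI (smooth_inZ itvI ntI (a := k / 2) Es) ws.
  exact: Ew.
- rewrite !mulf_neq0 ?invr_eq0 ?pnatr_eq0 ?expR_eq0//.
  exact: frame_speed_neq0 fr It.
- exact: dL.
move=> Y Z [Y1 [Y2 [Z1 [Z2 [YS ZS W]]]]].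
have [t0 /interior_subset I0] := ntI.
have Ys := model_structure k0 lE dL YS.
have Zs := model_structure k0 lE dL ZS.
apply: (congruent_of_structure itvI I0 _ (frame_free fr I0) Ys Zs).
  by move=> i; exact: frame_structure.
rewrite (_ : wronskian _ _ _ _ _ = k ^+ 3 / 8 * expR (L t0) ^+ 3 *
  wronskian Y1 Y2 Z1 Z2 (L t0)); last by rewrite /wronskian; field.
by rewrite !mulf_neq0 ?invr_eq0 ?expf_neq0 ?pnatr_eq0 ?expR_eq0.
Qed.

Lemma congruent_reparam x (D : set R) c A b (phi g : R -> R) :
  A \in unitmx -> smooth_in I phi ->
  (forall t, I t -> has_deriv_in I phi t (g t) /\ g t != 0) ->
  (forall t, I t -> D (phi t)) ->
  (forall t, I t -> ga_act A b (x t) = c (phi t)) ->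
  ga_congruent_to_arc I x D c.
Proof.
move=> Au phis dphi Dphi xE; exists A, b, phi; split => // t It.
have [d g0] := dphi t It.
by have [_ ->] := has_deriv_in_unique itvI ntI It d.
Qed.

End Classification.

(** * Fundamental pairs of solutions *)

Section FundamentalPairs.
Context {R : realType}.
Implicit Types (a b m p q r : R).

Definition exp_affine a p q r : R := expR (a * r) * (p + q * r).

Definition exp_trig a b p q r : R :=
  expR (a * r) * (p * cos (b * r) + q * sin (b * r)).

Lemma is_derive_scale a r : is_derive r (1 : R) (fun s => a * s) a.
Proof. by apply: is_derive_eq; rewrite /GRing.scale/= mulr1. Qed.

Lemma is_derive_expR_scale a r :
  is_derive r (1 : R) (fun s => expR (a * s)) (a * expR (a * r)).
Proof.
by rewrite mulrC;
  exact: is_derive1_comp (is_derive_expR (a * r)) (is_derive_scale a r).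
Qed.

Lemma is_derive_exp_affine a p q r :
  is_derive r (1 : R) (exp_affine a p q) (exp_affine a (a * p + q) (a * q) r).
Proof.
have h := is_derive_expR_scale a r.
by rewrite /exp_affine; apply: is_derive_eq; rewrite /GRing.scale/=; ring.
Qed.

Lemma is_derive_exp_trig a b p q r :
  is_derive r (1 : R) (exp_trig a b p q)
    (exp_trig a b (a * p + b * q) (a * q - b * p) r).
Proof.
have h := is_derive_expR_scale a r; have hb := is_derive_scale b r.
have hc := is_derive1_comp (is_derive_cos (b * r)) hb.
have hs := is_derive1_comp (is_derive_sin (b * r)) hb.
by rewrite /exp_trig; apply: is_derive_eq; rewrite /GRing.scale/=; ring.
Qed.

(** The first hypothesis says that [a] is a root of the characteristic
    polynomial [X^3 + 3 X^2 + (2 + m) X]; the second that this root is double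
    as soon as a factor [r] occurs. *)
Lemma log_solution_exp_affine m a p q :
  a ^+ 3 + 3 * a ^+ 2 + (2 + m) * a = 0 ->
  q * (3 * a ^+ 2 + 6 * a + (2 + m)) = 0 ->
  log_solution m (exp_affine a p q) (exp_affine a (a * p + q) (a * q))
    (exp_affine a (a * (a * p + q) + a * q) (a * (a * q))).
Proof.
move=> root droot; split=> r; try exact: is_derive_exp_affine.
apply: is_derive_eq (is_derive_exp_affine _ _ _ _) _.
apply: subr0_eq; rewrite /exp_affine; transitivity (expR (a * r) *
  ((p + q * r) * (a ^+ 3 + 3 * a ^+ 2 + (2 + m) * a) +
   q * (3 * a ^+ 2 + 6 * a + (2 + m)))); first by ring.
by rewrite root droot mulr0 addr0 mulr0.
Qed.

Lemma log_solution_exp_trig m b p q : 2 + m = 9 / 4 + b ^+ 2 ->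
  let a := - (3 / 2) in
  let p1 := a * p + b * q in let q1 := a * q - b * p in
  log_solution m (exp_trig a b p q) (exp_trig a b p1 q1)
    (exp_trig a b (a * p1 + b * q1) (a * q1 - b * p1)).
Proof.
move=> mE a p1 q1; split=> r; try exact: is_derive_exp_trig.
apply: is_derive_eq (is_derive_exp_trig _ _ _ _ _) _.
by rewrite /exp_trig mE /p1 /q1 /a; field.
Qed.

Lemma fundamental_pair_trig m b : b != 0 -> 2 + m = 9 / 4 + b ^+ 2 ->
  fundamental_pair m (exp_trig (- (3 / 2)) b 1 0) (exp_trig (- (3 / 2)) b 0 1).
Proof.
move=> b0 mE; do 4 eexists; split; try exact: log_solution_exp_trig mE.
move=> r; rewrite /wronskian /exp_trig.
(* for [z = a + i b] the wronskian of the real and imaginary parts of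
   [z e^(zr)] is [e^(2ar) |z|^2 b] *)
rewrite (_ : _ - _ = expR (- (3 / 2) * r) ^+ 2 * (9 / 4 + b ^+ 2) * b *
  (cos (b * r) ^+ 2 + sin (b * r) ^+ 2)); last by field.
rewrite cos2Dsin2 mulr1 !mulf_neq0// ?expf_neq0 ?expR_eq0//.
by have := sqr_ge0 b; lra.
Qed.

Lemma fundamental_pair_power m a b : a != 0 -> b != 0 -> a != b ->
  a + b = - 3 -> a * b = 2 + m ->
  fundamental_pair m (exp_affine a 1 0) (exp_affine b 1 0).
Proof.
move=> a0 b0 ab s p; do 4 eexists; split.
- by apply: log_solution_exp_affine; rewrite ?mul0r// -p; nra.
- by apply: log_solution_exp_affine; rewrite ?mul0r// -p; nra.
move=> r; rewrite /wronskian /exp_affine.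
rewrite (_ : _ - _ = expR (a * r) * expR (b * r) * a * b * (b - a)); last ring.
by rewrite !mulf_neq0// ?expR_eq0// subr_eq0 eq_sym.
Qed.

Lemma fundamental_pair_log m a : a != 0 -> a + a = - 3 -> a * a = 2 + m ->
  fundamental_pair m (exp_affine a 1 0) (exp_affine a 0 a).
Proof.
move=> a0 s p; do 4 eexists; split.
- by apply: log_solution_exp_affine; rewrite ?mul0r// -p; nra.
- by apply: log_solution_exp_affine; rewrite -p; nra.
move=> r; rewrite /wronskian /exp_affine.
rewrite (_ : _ - _ = expR (a * r) ^+ 2 * a ^+ 3); last ring.
by rewrite !mulf_neq0// ?expf_neq0 ?expR_eq0.
Qed.

Lemma fundamental_pair_exp m : 2 + m = 0 ->
  fundamental_pair m (exp_affine 0 0 (- 3)) (exp_affine (- 3) 1 0).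
Proof.
move=> mE; do 4 eexists; split.
- by apply: log_solution_exp_affine; rewrite mE; ring.
- by apply: log_solution_exp_affine; rewrite mE; ring.
move=> r; rewrite /wronskian /exp_affine.
rewrite (_ : _ - _ = - 27 * expR (0 * r) * expR (- 3 * r)); last ring.
by rewrite !mulf_neq0// ?expR_eq0// oppr_eq0 pnatr_eq0.
Qed.

End FundamentalPairs.

(** * The classification *)

Theorem proposition2p15 (R : realType) (I : set R) (x : R -> 'cV[R]_2) (k : R)
    (itvI : is_interval I) (ntI : I° !=set0)
    (smooth_x : smooth_in I x)
    (nondeg_x : nondegenerate_curve I x)
    (no_inflection : forall t, I t -> ~ affine_inflection I x t)
    (k_neq0 : k != 0)
    (curv_x : ga_curvature I x (fun=> k)) :
  [\/ exists2 gamma : R, gamma != 0 &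
        ga_congruent_to_arc I x [set: R]
          (fun t => expR (gamma * t) *: pt (cos t) (sin t)),
      ga_congruent_to_arc I x [set: R] (fun t => pt t (expR t)),
      ga_congruent_to_arc I x [set t | 0 < t] (fun t => pt t (t * ln t)) |
      exists2 alpha : R,
        [/\ alpha != 0, alpha != 1, alpha != -1, alpha != 2 & alpha != 2^-1] &
        ga_congruent_to_arc I x [set t | 0 < t]
          (fun t => pt t (t `^ alpha))].
Proof.
have [m m0 [h [L [hs h0 dL cong]]]] :=
  congruent_fundamental_pair itvI ntI smooth_x no_inflection k_neq0 curv_x.
have Ls : smooth_in I L := smooth_in_of_deriv itvI ntI dL hs.
have dlin a t : I t -> has_deriv_in I (fun t => a * L t) t (a * h t).
  by move=> It; apply: has_deriv_inZ => //; exact: dL.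
have slin a : smooth_in I (fun t => a * L t).
  exact: (@smooth_inZ _ _ itvI ntI a _ Ls).
have dexp a t : I t -> has_deriv_in I (fun t => expR (a * L t)) t
    (a * h t * expR (a * L t)).
  move=> It; have := has_deriv_in_comp It (dlin a t It) (is_derive_expR _).
  by move/has_deriv_in_eq; apply; rewrite mulrC.
have sexp a : smooth_in I (fun t => expR (a * L t)).
  apply: (smooth_in_linear_ode itvI ntI _ (dexp a)).
  exact: (@smooth_inZ _ _ itvI ntI a _ hs).
have congruent_lin a (D : set R) c A b : a != 0 -> A \in unitmx ->
    (forall t, I t -> D (a * L t)) ->
    (forall t, I t -> ga_act A b (x t) = c (a * L t)) ->
    ga_congruent_to_arc I x D c.
  move=> a0 Au DL xE; apply: (congruent_reparam itvI ntI Au (slin a) _ DL xE).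
  by move=> t It; split; [exact: dlin|rewrite mulf_neq0 ?h0].
have congruent_exp a c A b : a != 0 -> A \in unitmx ->
    (forall t, I t -> ga_act A b (x t) = c (expR (a * L t))) ->
    ga_congruent_to_arc I x [set t | 0 < t] c.
  move=> a0 Au xE; apply: (congruent_reparam itvI ntI Au (sexp a)).
  - move=> t It; split; first exact: dexp.
    by rewrite !mulf_neq0 ?h0 ?expR_eq0.
  - by move=> t It /=; rewrite expR_gt0.
  - exact: xE.
(* [1 - 4 m] is the discriminant of [X^2 + 3 X + 2 + m] *)
have [m4|m4|m4] := ltgtP m (1 / 4).
- have d0 : 0 < 1 - 4 * m by lra.
  have d2 := sqr_sqrtr (ltW d0).
  have s0 : 0 < Num.sqrt (1 - 4 * m) by rewrite sqrtr_gt0.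
  set d := Num.sqrt _ in d2 s0.
  have [m2|m2] := eqVneq m (- 2).
    have mE : 2 + m = 0 by lra.
    apply: Or42; have [A [b [Au xE]]] := cong _ _ (fundamental_pair_exp mE).
    apply: (congruent_lin (- 3) _ _ A b) => //.
    move=> t It; rewrite xE// /exp_affine !mul0r expR0.
    by rewrite mul1r add0r addr0 mulr1.
  pose a := (- 3 - d) / 2; pose b := (- 3 + d) / 2.
  have ab : a * b = 2 + m by rewrite /a /b; nra.
  have ab0 : a * b != 0 by rewrite ab; apply: contra m2; lra.
  have a0 : a != 0 by apply: contraNneq ab0 => ->; rewrite mul0r.
  have b0 : b != 0 by apply: contraNneq ab0 => ->; rewrite mulr0.
  have sab : a + b = - 3 by rewrite /a /b; lra.
  have neq : a != b by rewrite /a /b; lra.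
  apply: Or44; exists (b / a).
    split.
    - by rewrite mulf_neq0 ?invr_eq0.
    - by apply: contra neq => /eqP e; rewrite -[b](divfK a0) e mul1r.
    - apply/eqP => e; have : b = - a by rewrite -[b](divfK a0) e mulN1r.
      lra.
    (* with [a + b = -3], [b = 2 a] gives [a b = 2], that is [m = 0] *)
    - apply/eqP => e; have bE : b = 2 * a by rewrite -[b](divfK a0) e.
      by move/eqP: m0; apply; nra.
    - apply/eqP => e; have bE : b = 2^-1 * a by rewrite -[b](divfK a0) e.
      by move/eqP: m0; apply; nra.
  have [A [c [Au xE]]] := cong _ _ (fundamental_pair_power a0 b0 neq sab ab).
  apply: (congruent_exp a _ A c) => // t It.
  rewrite xE// /exp_affine !mul0r !addr0 !mulr1 /powR gt_eqF ?expR_gt0// expRK.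
  by rewrite mulrA divfK.
- have b2 : 0 < m - 1 / 4 by lra.
  have bb := sqr_sqrtr (ltW b2).
  have b0 : Num.sqrt (m - 1 / 4) != 0 by rewrite gt_eqF// sqrtr_gt0.
  set b := Num.sqrt _ in bb b0.
  apply: Or41; exists (- (3 / 2) / b).
    by rewrite mulf_neq0 ?invr_eq0//; lra.
  have mE : 2 + m = 9 / 4 + b ^+ 2 by lra.
  have [A [c [Au xE]]] := cong _ _ (fundamental_pair_trig b0 mE).
  apply: (congruent_lin b _ _ A c) => // t It.
  rewrite xE// /exp_trig mulrA divfK// !mul0r !mul1r addr0 add0r.
  by apply/colP => i; rewrite !mxE; case: ifP.
- apply: Or43; pose a : R := - (3 / 2).
  have a0 : a != 0 by rewrite /a; lra.
  have sa : a + a = - 3 by rewrite /a; lra.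
  have pa : a * a = 2 + m by rewrite /a m4; lra.
  have [A [c [Au xE]]] := cong _ _ (fundamental_pair_log a0 sa pa).
  apply: (congruent_exp a _ A c) => // t It.
  by rewrite xE// /exp_affine mul0r addr0 mulr1 add0r expRK.
Qed.
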